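(* There exists an absolute constant $c>0$ such that the following holds. For every $T\ge 1$, every $k\in\{1,\dots,T-1\}$, and every randomized learning algorithm $\mathfrak{A}$ that uses $k$ best-action queries over horizon $T$, there exists a multi-armed bandit instance with two arms and stochastic correlated rewards (that is, a joint distribution $D$ on $[0,1]^2$) such that the regret of $\mathfrak{A}$ on this instance satisfies \[ R_{T,k}(\mathfrak{A})\ \ge\ c\,\sqrt{T-k}. \]
   Context: Multi-armed bandits with best-action queries. There are $n$ arms and a horizon of $T$ rounds. At each round $t\in\{1,\dots,T\}$ the environment generates a reward vector $X_t=(X_{t,1},\dots,X_{t,n})\in[0,1]^n$. In the stochastic correlated setting, the vectors $X_1,\dots,X_T$ are drawn independently from a joint distribution $D$ on $[0,1]^n$ (the coordinates of $X_t$ may be dependent), and $D$ is unknown to the learner. The learner has a budget of $k$ best-action queries. At the beginning of round $t$, based on its past observations and internal randomness (and before seeing anything about $X_t$), the learner decides whether to query the oracle. It may query in at most $k$ rounds in total. - If it queries, the oracle reveals an arm $i_t^\star\in\arg\max_{i} X_{t,i}$, the learner plays $I_t=i_t^\star$ and observes $X_{t,i_t^\star}$. - If it does not query, the learner selects an arm $I_t$ (based on past observations and internal randomness) and observes only $X_{t,I_t}$ (bandit feedback). The regret of algorithm $\mathfrak{A}$ is \[ R_{T,k}(\mathfrak{A})=\max_{i}\sum_{t=1}^T\mathbb{E}[X_{t,i}]-\mathbb{E}\Big[\sum_{t=1}^T X_{t,I_t}\Big], \] with expectation over the randomness of the algorithm and of the environment. *)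

(* Defs.v *)
From HB Require Import structures.
From mathcomp Require Import all_boot all_order all_algebra.
From mathcomp Require Import all_classical all_reals all_analysis.

Set Implicit Arguments.
Unset Strict Implicit.
Unset Printing Implicit Defensive.

Import Order.TTheory GRing.Theory Num.Theory.

Local Open Scope classical_set_scope.
Local Open Scope ring_scope.

(* i.i.d. product measure D^T on T-tuples; MathComp-Analysis only has the     *)
(* binary product, so it is built by pushing D \x D^T forward along "cons".   *)
Section iid_law.
Context d (E : measurableType d) (R : realType).

Definition cons_tuple T (p : E * T.-tuple E) : T.+1.-tuple E :=
  [the T.+1.-tuple E of p.1 :: p.2].

Lemma measurable_cons_tuple T : measurable_fun setT (@cons_tuple T).
Proof. exact: measurable_cons. Qed.

HB.instance Definition _ T :=
  isMeasurableFun.Build _ _ _ _ (@cons_tuple T) (@measurable_cons_tuple T).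

Fixpoint iid_law (D : probability E R) T : probability (T.-tuple E) R :=
  match T with
  | 0 => dirac [tuple]
  | T'.+1 => distribution (D \x iid_law D T')%E (@cons_tuple T')
  end.

End iid_law.

Section bandit.
Context {R : realType} {n : nat}.

Definition reward_cube : set (n.-tuple R) :=
  [set x | forall i, 0 <= tnth x i <= 1].

(* One entry (I_t, X_{t,I_t}) per past round. Whether a past round was a      *)
(* query is not recorded: the learner can recompute it from its seed.         *)
Definition history := seq ('I_n * R).

(* Internal randomness is a seed drawn from an arbitrary probability space.   *)
(* [alg_act s h] is the decision in round [size h] (rounds count from 0):     *)
(* [None] queries the oracle, [Some i] plays arm i without a query.           *)
Record algorithm := Algorithm {
  alg_disp : measure_display;
  alg_seed : measurableType alg_disp;
  alg_law : probability alg_seed R;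
  alg_act : alg_seed -> history -> option 'I_n;
  alg_measurable : forall t (arms : t.-tuple 'I_n) (a : option 'I_n),
    measurable [set p : alg_seed * t.-tuple R |
                alg_act p.1 (zip arms p.2) = a]
}.

(* [b t x] is the arm revealed by a query in round t when X_t = x. Ties are   *)
(* resolved by an arbitrary measurable rule, which may vary with the round.   *)
Definition best_action_oracle (b : nat -> n.-tuple R -> 'I_n) : Prop :=
  (forall t x j, tnth x j <= tnth x (b t x)) /\
  (forall t i, measurable [set x | b t x = i]).

Section run.
Variables (A : algorithm) (b : nat -> n.-tuple R -> 'I_n) (s : alg_seed A).

Definition played_arm (h : history) (x : n.-tuple R) : 'I_n :=
  if alg_act s h is Some i then i else b (size h) x.

Definition play_round (h : history) (x : n.-tuple R) : history :=
  rcons h (played_arm h x, tnth x (played_arm h x)).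

Definition run (xs : seq (n.-tuple R)) : history := foldl play_round [::] xs.

Definition num_queries (xs : seq (n.-tuple R)) : nat :=
  \sum_(t < size xs) (alg_act s (take t (run xs)) == None).

Definition total_reward (xs : seq (n.-tuple R)) : R :=
  \sum_(o <- run xs) o.2.

End run.

Definition within_budget (A : algorithm) (T k : nat) : Prop :=
  forall b, best_action_oracle b ->
  forall (s : alg_seed A) (xs : T.-tuple (n.-tuple R)),
    (forall t, reward_cube (tnth xs t)) -> (num_queries b s xs <= k)%N.

Definition regret (A : algorithm) (D : probability (n.-tuple R) R)
    (b : nat -> n.-tuple R -> 'I_n) (T : nat) : \bar R :=
  let P := (alg_law A \x iid_law D T)%E in
  (\big[maxe/-oo]_(i < n) (\sum_(t < T) 'E_P[fun w => tnth (tnth w.2 t) i])%E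
   - 'E_P[fun w => total_reward b w.1 w.2])%E.

End bandit.

Arguments reward_cube : clear implicits.
Arguments algorithm : clear implicits.

(* Main.v *)
Require Import Defs.
From HB Require Import structures.
From mathcomp Require Import all_boot all_order all_algebra.
From mathcomp Require Import all_classical all_reals all_analysis.
From mathcomp Require Import measurable_realfun.
From mathcomp Require Import ring lra zify.

(* There are two instances, one per arm [g]. Their reward vectors differ by a *)
(* tiny [e] in most rounds, and favour [g] by a full unit with a small        *)
(* probability [p]; the argmax is made uniform and independent of the maximum,*)
(* with the same law in both instances. A query thus reveals nothing about    *)
(* [g] and gains only [e / 2] in expectation over always playing [g], so that *)
(* up to [e * T] only the [m = T - k] forced unqueried rounds matter. There   *)
(* the two instances are an ordinary two-point bandit problem, whose gap      *)
(* [p ~ 1 / sqrt m] cannot be detected: the likelihood ratios [x], [y] of the *)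
(* two instances with respect to the uniform instance [p = 0] satisfy         *)
(* [min x y >= (x + y) / 2 - 1 / 4 - (x - y)^2 / 4], and [x * y] is a         *)
(* martingale, since each round updates only one of [x] and [y]. All this is  *)
(* carried out for a fixed seed, which is integrated out at the end.          *)

Set Implicit Arguments.
Unset Strict Implicit.
Unset Printing Implicit Defensive.

Import Order.TTheory GRing.Theory Num.Theory.

Local Open Scope classical_set_scope.
Local Open Scope ring_scope.

(** * Iterated means and i.i.d. draws from a finitely supported law *)

(** For a fixed seed the learner is deterministic. [likelihood_weight] moves both instances to the
    uniform law on four atoms, so that they share one tree of histories, each with its own
    likelihood weight. On that tree [expected_lossS] is the Bellman equation of the loss, and
    [potential_bound] bounds the weighted sum of the two losses by backward induction. Each
    unqueried play is wrong in one of the instances, so after [m] of them the weighted number of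
    wrong plays is at least [m] times the smaller weight ([potential_end]); [potential_step] says
    that the average potential does not fall from one round to the next.

    With [p] and [e] tuned, [total_expected_loss_ge] makes the two losses add up to at least
    [sqrt m / 64] for every seed. [expectation_mean] passes from seeds to expectations, and
    [regret_lower_bound] concludes that one instance costs at least half of this. *)

Fixpoint mean (R : realType) (E : Type) (N : nat) (w : nat -> R) (x : nat -> E)
    (n : nat) (f : seq E -> R) : R :=
  if n is n'.+1 then
    \sum_(j < N) w j * mean N w x n' (fun xs => f (x j :: xs))
  else f [::].

Section mean_coordinate.
Context (R : realType) (E : Type) (N : nat) (w : nat -> R) (x : nat -> E).
Hypothesis w_sum : \sum_(j < N) w j = 1.

Lemma mean_cst n c : mean N w x n (fun=> c) = c.
Proof.
elim: n => //= n IH; under eq_bigr do rewrite IH.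
by rewrite -mulr_suml w_sum mul1r.
Qed.

Lemma mean_nth n t y (F : E -> R) : (t < n)%N ->
  mean N w x n (fun xs => F (nth y xs t)) = \sum_(j < N) w j * F (x j).
Proof.
elim: n t => [//|n IH] [|t] ht /=.
  by apply: eq_bigr => j _; rewrite mean_cst.
under eq_bigr do rewrite IH//.
by rewrite -mulr_suml w_sum mul1r.
Qed.

End mean_coordinate.

Section finite_law.
Context d (E : measurableType d) (R : realType).
Variables (N : nat) (w : nat -> R) (x : nat -> E).
Hypotheses (w_ge0 : forall j, 0 <= w j) (w_sum : \sum_(j < N) w j = 1).

(** The sum of the point masses [w j] at [x j], described by its integrals of nonnegative functions,
    which is how it is used. *)
Definition is_finite_law (D : probability E R) := forall f : E -> \bar R,
  measurable_fun setT f -> (forall y, (0 <= f y)%E) ->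
  (\int[D]_y f y = \sum_(j < N) (w j)%:E * f (x j))%E.

Lemma finite_law_exists : exists D : probability E R, is_finite_law D.
Proof.
pose mu := msum (fun j => mscale (NngNum (normr_ge0 (w j))) (dirac (x j) : {measure set E -> \bar R})) N.
have muE f : measurable_fun setT f -> (forall y, (0 <= f y)%E) ->
    (\int[mu]_y f y = \sum_(j < N) (w j)%:E * f (x j))%E.
  move=> mf f0; rewrite ge0_integral_measure_sum//; apply: eq_bigr => j _.
  by rewrite ge0_integral_mscale//= integral_dirac//= diracT mul1e ger0_norm// w_ge0.
have mu1 : mu setT = 1%E.
  rewrite -[mu setT]mul1e -integral_cst// muE//.
  by under eq_bigr do rewrite /cst mule1; rewrite sumEFin w_sum.
pose H := @Measure_isProbability.Build _ _ R (mu : set E -> \bar R) mu1.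
pose M : {measure set E -> \bar R} := mu.
pose D : probability E R := HB.pack_for (Probability.type E R) (Measure.sort M) H.
by exists D.
Qed.

Lemma mean_ext n (f g : seq E -> R) :
  (forall js : seq 'I_N, size js = n -> f [seq x j | j : 'I_N <- js] = g [seq x j | j : 'I_N <- js]) ->
  mean N w x n f = mean N w x n g.
Proof.
elim: n f g => [|n IH] f g fg /=; first exact: (fg [::]).
apply: eq_bigr => j _; congr (_ * _); apply: IH => js hjs.
by apply: (fg (j :: js)); rewrite /= hjs.
Qed.

Lemma mean_ge n (f : seq E -> R) c :
  (forall js : seq 'I_N, size js = n -> c <= f [seq x j | j : 'I_N <- js]) ->
  c <= mean N w x n f.
Proof.
elim: n f => [|n IH] f fc /=; first exact: (fc [::]).
rewrite -[leLHS]mul1r -w_sum mulr_suml; apply: ler_sum => j _.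
apply: ler_wpM2l; first exact: w_ge0.
by apply: IH => js hjs; apply: (fc (j :: js)); rewrite /= hjs.
Qed.

Variables (D : probability E R) (hD : is_finite_law D).

(** Tonelli peels off one draw at a time, following the common recursion of [iid_law] and [mean]. *)
Lemma integral_iid_law n (f : seq E -> R) :
  measurable_fun setT (fun xs : n.-tuple E => f xs) -> (forall xs, 0 <= f xs) ->
  (\int[iid_law D n]_xs (f xs)%:E = (mean N w x n f)%:E)%E.
Proof.
elim: n f => [|n IH] f mf f0 /=.
  by rewrite integral_dirac// ?diracT ?mul1e//; apply/measurable_EFinP.
rewrite ge0_integral_distribution//; first last.
- by move=> y; rewrite lee_fin.
- exact/measurable_EFinP.
rewrite /comp fubini_tonelli1//; first last.
- by move=> y; rewrite lee_fin.
- by apply/measurable_EFinP; apply: (measurableT_comp mf); exact: measurable_cons_tuple.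
rewrite /fubini_F.
have E1 y : (\int[iid_law D n]_z (f (Defs.cons_tuple (y, z)))%:E =
    (mean N w x n (fun xs => f (y :: xs)))%:E)%E.
  rewrite -IH//; apply: (measurableT_comp mf).
  by apply: measurable_cons => //; exact: measurable_cst.
under eq_integral do rewrite E1.
rewrite hD.
- by rewrite -sumEFin; apply: eq_bigr => j _; rewrite EFinM.
- under eq_fun do rewrite -E1.
  apply: (@measurable_fun_fubini_tonelli_F _ _ _ _ _ (iid_law D n)
    (fun p : E * n.-tuple E => (f (Defs.cons_tuple p))%:E)).
    by apply/measurable_EFinP; apply: (measurableT_comp mf); exact: measurable_cons_tuple.
  by move=> y; rewrite lee_fin.
- by move=> y; rewrite lee_fin; apply: mean_ge => js _.
Qed.

Context dS (S : measurableType dS) (L : probability S R).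
Variables (n : nat) (f : S -> seq E -> R).
Hypothesis mf : measurable_fun setT (fun u : S * n.-tuple E => f u.1 u.2).
Hypothesis f0 : forall s (js : seq 'I_N), size js = n -> 0 <= f s [seq x j | j : 'I_N <- js].

(* [f] need not be nonnegative, or even bounded, off the atoms.               *)
Let fp s xs := Num.max (f s xs) 0.
Let fn s xs := Num.max (- f s xs) 0.

Let mfp : measurable_fun setT (fun u : S * n.-tuple E => (fp u.1 u.2)%:E).
Proof. by apply/measurable_EFinP; apply: measurable_maxr. Qed.

Let mfn : measurable_fun setT (fun u : S * n.-tuple E => (fn u.1 u.2)%:E).
Proof. by apply/measurable_EFinP; apply: measurable_maxr => //; exact: measurableT_comp. Qed.

Let fpE s : (\int[iid_law D n]_xs (fp s xs)%:E = (mean N w x n (f s))%:E)%E.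
Proof.
rewrite integral_iid_law.
- by congr EFin; apply: mean_ext => js hjs; rewrite /fp max_l// f0.
- by have /measurable_EFinP h := mfp; exact: (measurableT_comp h (pair1_measurable s)).
- by move=> xs; rewrite /fp le_max lexx orbT.
Qed.

Let fnE s : (\int[iid_law D n]_xs (fn s xs)%:E = 0)%E.
Proof.
rewrite integral_iid_law.
- rewrite (@mean_ext _ _ (fun=> 0)); last by move=> js hjs; rewrite /fn max_r// oppr_le0 f0.
  by rewrite mean_cst.
- by have /measurable_EFinP h := mfn; exact: (measurableT_comp h (pair1_measurable s)).
- by move=> xs; rewrite /fn le_max lexx orbT.
Qed.

Lemma measurable_mean : measurable_fun setT (fun s => (mean N w x n (f s))%:E).
Proof.
under eq_fun do rewrite -fpE.
apply: (@measurable_fun_fubini_tonelli_F _ _ _ _ _ (iid_law D n)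
    (fun u : S * n.-tuple E => (fp u.1 u.2)%:E)) => //.
by move=> u; rewrite lee_fin /fp le_max lexx orbT.
Qed.

(** Tonelli is applied separately to the positive and negative parts; the latter vanishes on the
    atoms and integrates to 0. *)
Lemma expectation_mean :
  ('E_(L \x iid_law D n)[fun u => f u.1 u.2] = \int[L]_s (mean N w x n (f s))%:E)%E.
Proof.
rewrite unlock integralE.
rewrite [X in (X - _)%E = _](_ : _ = \int[L]_s (mean N w x n (f s))%:E)%E.
  rewrite [X in (_ - X)%E = _](_ : _ = 0)%E ?sube0//.
  rewrite (_ : _^\- = (fun u : S * n.-tuple E => (fn u.1 u.2)%:E))%E; last first.
    by apply/funext => u; rewrite funenegE /fn EFin_max.
  rewrite fubini_tonelli1//=; last by move=> u; rewrite lee_fin /fn le_max lexx orbT.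
  by rewrite /fubini_F/=; under eq_integral do rewrite fnE; rewrite integral0.
rewrite (_ : _^\+ = (fun u : S * n.-tuple E => (fp u.1 u.2)%:E))%E; last first.
  by apply/funext => u; rewrite funeposE /fp EFin_max.
rewrite fubini_tonelli1//=; last by move=> u; rewrite lee_fin /fp le_max lexx orbT.
by rewrite /fubini_F/=; under eq_integral do rewrite fpE.
Qed.

End finite_law.

(** * Measurability of the total reward *)

Section measurability.
Context {R : realType} {n : nat}.
Variables (A : algorithm R n) (b : nat -> n.-tuple R -> 'I_n).
Hypothesis hb : best_action_oracle b.

(** Rewards are determined by the arms played and the reward vectors. Freezing the arms thus makes
    the history a measurable function of the outcome, the form that [alg_measurable] expects. *)
Lemma unzip2_run s (xs : seq (n.-tuple R)) :
  unzip2 (run b s xs) = [seq tnth u.2 u.1 | u <- zip (unzip1 (run (A := A) b s xs)) xs].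
Proof.
elim/last_ind: xs => [//|xs x IH]; rewrite /run foldl_rcons -/(run b s xs).
rewrite /play_round /unzip1 /unzip2 !map_rcons -/(unzip1 _) -/(unzip2 _) IH.
rewrite zip_rcons ?map_rcons// size_map.
by elim/last_ind: {IH} xs => // ys y IH; rewrite /run foldl_rcons !size_rcons -IH.
Qed.

Context d (W : measurableType d) (s : W -> alg_seed A) (x : nat -> W -> n.-tuple R).
Hypotheses (ms : measurable_fun setT s) (mx : forall t, measurable_fun setT (x t)).

Let xs t u := [seq x i u | i <- iota 0 t].

Lemma size_run u t : size (run b (s u) (xs t u)) = t.
Proof.
elim: t => [//|t IH]; rewrite /xs -addn1 iotaD map_cat cats1 /run foldl_rcons size_rcons.
by rewrite addn1; congr _.+1.
Qed.

Lemma zip_arms t (arms : t.-tuple 'I_n) u :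
  zip arms (xs t u) = [seq (tnth arms i, x i u) | i : 'I_t <- enum 'I_t].
Proof.
rewrite -{1}(map_tnth_enum arms) /xs -val_enum_ord -map_comp.
by elim: (enum 'I_t) => //= i r ->.
Qed.

Lemma measurable_arms t (arms : t.-tuple 'I_n) :
  measurable [set u | unzip1 (run b (s u) (xs t u)) = arms].
Proof.
elim: t arms => [|t IH] arms.
  rewrite (_ : [set _ | _] = setT)//; apply/seteqP; split => // u _ /=.
  by rewrite tuple0.
have [arms' [a harms]] : exists (arms' : t.-tuple 'I_n) a, tval arms = rcons arms' a.
  case: arms => s0 /=; case/lastP: s0 => [//|s0 a]; rewrite size_rcons eqSS => hs0.
  by exists (Tuple hs0), a.
pose rewards (u : W) : t.-tuple R := [tuple tnth (x i u) (tnth arms' i) | i < t].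
have mr : measurable_fun setT (fun u => (s u, rewards u)).
  apply/measurable_fun_pairP; split => //; apply/measurable_fun_tnthP => i.
  rewrite (_ : _ \o _ = (fun y : n.-tuple R => tnth y (tnth arms' i)) \o x i).
    by apply: measurableT_comp => //; exact: measurable_tnth.
  by apply/funext => u /=; rewrite tnth_mktuple.
pose act u := alg_act (s u) (zip arms' (rewards u)).
have mact o : measurable [set u | act u = o].
  have := mr measurableT _ (alg_measurable arms' o); rewrite setTI.
  exact.
rewrite (_ : [set _ | _] = [set u | unzip1 (run b (s u) (xs t u)) = arms'] `&`
    ([set u | act u = Some a] `|`
     ([set u | act u = None] `&` x t @^-1` [set y | b t y = a]))).
  apply: measurableI; first exact: IH.
  apply: measurableU => //; apply: measurableI => //.
  by rewrite -[X in measurable X]setTI; apply: mx => //; apply: hb.2.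
have actE u : unzip1 (run b (s u) (xs t u)) = arms' ->
    act u = alg_act (s u) (run b (s u) (xs t u)).
  move=> h; rewrite /act -(zip_unzip (run b (s u) (xs t u))) unzip2_run h.
  by congr (alg_act _ (zip _ _)); rewrite zip_arms -map_comp.
have runS u : run b (s u) (xs t.+1 u) = play_round b (s u) (run b (s u) (xs t u)) (x t u).
  by rewrite /xs -addn1 iotaD map_cat cats1 /run foldl_rcons.
apply/seteqP; split => u /=; rewrite runS /play_round /unzip1 map_rcons -/(unzip1 _) harms.
  move=> /rcons_inj[h1 /=]; rewrite /played_arm -actE// size_run => h2.
  by split=> //; case: (act u) h2 => [i ->|]; [left|right].
move=> [h1 h2]; rewrite /= h1; congr rcons; rewrite /played_arm -actE// size_run.
by case: h2 => [->|[-> ]].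
Qed.

(** There are finitely many arm sequences, and on the event of each one the reward is a sum of fixed
    coordinates. *)
Lemma measurable_total_reward t :
  measurable_fun setT (fun u => total_reward b (s u) (xs t u)).
Proof.
rewrite (_ : (fun u => _) = fun u => \sum_(arms : t.-tuple 'I_n)
   \1_[set v | unzip1 (run b (s v) (xs t v)) = arms] u *
   \sum_(i < t) tnth (x i u) (tnth arms i)).
  apply: measurable_sum => arms; apply: measurable_funM.
    exact/measurable_indic/measurable_arms.
  apply: measurable_sum => i.
  apply: (measurableT_comp (f := fun y : n.-tuple R => tnth y (tnth arms i))) => //.
  exact: measurable_tnth.
apply/funext => u.
have hs : size (unzip1 (run b (s u) (xs t u))) == t by rewrite size_map size_run.
rewrite (bigD1 (Tuple hs))//= [X in _ = _ + X]big1 ?addr0 => [|arms harms]; last first.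
  rewrite ?indicE memNset ?mul0r//= => h; move/eqP: harms; apply.
  by apply: val_inj; rewrite /= h.
rewrite ?indicE mem_set//= mul1r /total_reward.
have -> : \sum_(o <- run b (s u) (xs t u)) o.2 = \sum_(y <- unzip2 (run b (s u) (xs t u))) y.
  by rewrite /unzip2 big_map.
by rewrite unzip2_run big_map (zip_arms (Tuple hs)) big_map big_enum.
Qed.

End measurability.

(** * The two hard instances *)

Section run.
Context {R : realType} {n : nat}.
Variables (A : algorithm R n) (b : nat -> n.-tuple R -> 'I_n) (s : alg_seed A).

Definition run_from (h : history (R := R)) (xs : seq (n.-tuple R)) : history :=
  foldl (play_round b s) h xs.

Lemma take_run_from h xs : take (size h) (run_from h xs) = h.
Proof.
elim: xs h => [|x xs IH] h /=; first by rewrite take_size.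
have := congr1 (take (size h)) (IH (play_round b s h x)).
rewrite -take_min size_rcons (minn_idPl _)// => ->.
by rewrite /play_round -cats1 take_size_cat.
Qed.

Definition queries_from (h : history (R := R)) (xs : seq (n.-tuple R)) : nat :=
  \sum_(t < size xs) (alg_act s (take (size h + t) (run_from h xs)) == None).

Lemma queries_from_cons h x xs : queries_from h (x :: xs) =
  ((alg_act s h == None) + queries_from (play_round b s h x) xs)%N.
Proof.
rewrite /queries_from big_ord_recl/= addn0.
rewrite (take_run_from h (x :: xs)); congr addn.
apply: eq_bigr => i _; rewrite size_rcons /bump/= addnA addn1.
by rewrite addSn.
Qed.

End run.

Section hard_instance.
Context {R : realType}.

(* No atom has a tie, so the rule by which the oracle breaks them is          *)
(* irrelevant.                                                                *)
Definition atom (e : R) (j : nat) : 2.-tuple R :=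
  match j with
  | 0 => [tuple 1; 1 - e]
  | 1 => [tuple 1 - e; 1]
  | 2 => [tuple e; 0]
  | 3 => [tuple 0; e]
  | 4 => [tuple 1; 0]
  | _ => [tuple 0; 1]
  end.

Definition weight (p : R) (g : 'I_2) (j : nat) : R :=
  match j with
  | 0 => if g == ord0 then 1 / 4 - p else 1 / 4
  | 1 => if g == ord0 then 1 / 4 else 1 / 4 - p
  | 4 => if g == ord0 then p else 0
  | 5 => if g == ord0 then 0 else p
  | _ => 1 / 4
  end.

(* Likelihood ratio between [weight p g] and the uniform law on the first     *)
(* four atoms, for the feedback to action [a] when the atom is [j]. Only      *)
(* playing the bad arm [rev_ord g] is informative: its values [1 - e] and [0] *)
(* have probabilities [1 / 4 - p] and [1 / 4 + p].                            *)
Definition likelihood (p : R) (g : 'I_2) (a : option 'I_2) (j : nat) : R :=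
  if (a == Some (rev_ord g)) && (odd j == odd g) then
    if (j < 2)%N then 1 - 4 * p else 1 + 4 * p
  else 1.

Lemma ord2P (i : 'I_2) : i = ord0 \/ i = ord_max.
Proof. by case: i => [[|[|//]] hi]; [left|right]; apply: val_inj. Qed.

Lemma oracle_atom (e : R) b t j : 0 < e < 1 / 2 -> best_action_oracle b ->
  (j < 6)%N -> b t (atom e j) = if odd j then ord_max else ord0.
Proof.
move=> he [/(_ t (atom e j)) hb _] hj.
have := (hb ord0, hb ord_max).
case: (ord2P (b t (atom e j))) => ->;
by case: j hj {hb} => [|[|[|[|[|[|//]]]]]] _ //= [];
  rewrite !(tnth_nth 0)/= => h1 h2; exfalso; lra.
Qed.

Definition answer (b : nat -> 2.-tuple R -> 'I_2) (a : option 'I_2) t x : 'I_2 :=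
  if a is Some i then i else b t x.

(** Feedback cannot tell the rare atom from the first four. For [g = ord0], atom 4 looks like atom 0
    through arm [ord0] or a query, and like atom 2 through arm [ord_max]; moving mass [p] from atom
    0 to atom 4 is visible only through the bad arm. *)
Lemma likelihood_weight (p e : R) b g a t (F : 'I_2 -> R -> R) :
  0 < e < 1 / 2 -> best_action_oracle b ->
  let G j := F (answer b a t (atom e j)) (tnth (atom e j) (answer b a t (atom e j))) in
  \sum_(j < 6) weight p g j * G j = 1 / 4 * \sum_(j < 4) likelihood p g a j * G j.
Proof.
move=> he hb G.
have o j := @oracle_atom e b t j he hb.
have /= o0 := o 0 isT; have /= o1 := o 1 isT; have /= o2 := o 2 isT.
have /= o3 := o 3 isT; have /= o4 := o 4 isT; have /= o5 := o 5 isT.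
rewrite !big_ord_recl !big_ord0 /G /answer /bump/= ?add1n /weight /likelihood/=.
case: a {G} => [i|]; rewrite ?(o0, o1, o2, o3, o4, o5)//;
  case: (ord2P g) => ->; [case: (ord2P i) => ->|case: (ord2P i) => ->| |];
  rewrite ?(tnth_nth 0)/= /eq_op/=; by field.
Qed.

Lemma likelihood_sum p g a : \sum_(j < 4) likelihood p g a j = 4.
Proof.
rewrite !big_ord_recl big_ord0 /bump/= /likelihood/=.
by case: (ord2P g) => ->; case: eqP => _ //=; ring.
Qed.

(** Mean of [1 / 2] minus the reward: the good arm has mean [1 / 2], the bad one
    [1 / 2 - p * (1 - e)], the maximum [1 / 2 + e / 2]. *)
Definition round_loss (p e : R) (g : 'I_2) (a : option 'I_2) : R :=
  if a is Some i then if i == g then 0 else p * (1 - e) else - (e / 2).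

Lemma likelihood_loss (p e : R) b g a t :
  0 < e < 1 / 2 -> best_action_oracle b ->
  \sum_(j < 4) likelihood p g a j *
    (1 / 2 - tnth (atom e j) (answer b a t (atom e j))) = 4 * round_loss p e g a.
Proof.
move=> he hb.
have o j := @oracle_atom e b t j he hb.
have /= o0 := o 0 isT; have /= o1 := o 1 isT; have /= o2 := o 2 isT.
have /= o3 := o 3 isT.
rewrite !big_ord_recl !big_ord0 /answer /bump/= ?add1n /likelihood /round_loss/=.
case: a => [i|]; rewrite ?(o0, o1, o2, o3)//;
  case: (ord2P g) => ->; [case: (ord2P i) => ->|case: (ord2P i) => ->| |];
  rewrite ?(tnth_nth 0)/= /eq_op/=; by field.
Qed.

Lemma likelihood_ge0 p g a j : 0 <= p <= 1 / 4 -> 0 <= likelihood p g a j.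
Proof. by move=> hp; rewrite /likelihood; case: ifP => _; [case: ifP => _|]; lra. Qed.

End hard_instance.

(** * The potential argument *)

Section potential.
Context {R : realType}.
Variables (A : algorithm R 2) (s : alg_seed A) (p e : R).
Hypotheses (hp : 0 <= p <= 1 / 4) (he : 0 < e < 1 / 2).

(** Given the history [h], the shortfall over the [n] rounds to come against always playing [g],
    which earns [1 / 2] per round. The rewards of [h] cancel, since [run_from] keeps them. *)
Definition expected_loss (g : 'I_2) (b : nat -> 2.-tuple R -> 'I_2)
    (h : history (R := R)) (n : nat) : R :=
  \sum_(o <- h) o.2 + n%:R / 2 -
  mean 6 (weight p g) (atom e) n (fun xs => \sum_(o <- run_from b s h xs) o.2).

Lemma expected_lossS g b h n : best_action_oracle b ->
  expected_loss g b h n.+1 = round_loss p e g (alg_act s h) +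
  1 / 4 * \sum_(j < 4) likelihood p g (alg_act s h) j *
    expected_loss g b (play_round b s h (atom e j)) n.
Proof.
move=> hb.
have -> : round_loss p e g (alg_act s h) = 1 / 4 * (4 * round_loss p e g (alg_act s h)).
  by field.
rewrite -(likelihood_loss p g (alg_act s h) (size h) he hb) -mulrDr -big_split/=.
rewrite {1}/expected_loss/=.
(* The continuation value as a function of the observed arm and reward only, so that
   [likelihood_weight] applies to it. *)
pose F i v := \sum_(o <- h) o.2 + v + n%:R / 2 - expected_loss g b (rcons h (i, v)) n.
have -> : \sum_(j < 6) weight p g j * mean 6 (weight p g) (atom e) n
    (fun xs => \sum_(o <- foldl (play_round b s) (play_round b s h (atom e j)) xs) o.2) =
  \sum_(j < 6) weight p g j * F (answer b (alg_act s h) (size h) (atom e j))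
     (tnth (atom e j) (answer b (alg_act s h) (size h) (atom e j))).
  apply: eq_bigr => j _; congr (_ * _).
  rewrite /F /expected_loss -cats1 big_cat big_seq1/= /play_round -cats1.
  by rewrite subKr.
rewrite (likelihood_weight p g (alg_act s h) (size h) F he hb).
have -> : \sum_(o <- h) o.2 + n.+1%:R / 2 =
  1 / 4 * ((\sum_(o <- h) o.2 + n.+1%:R / 2) *
    \sum_(j < 4) likelihood p g (alg_act s h) j) by rewrite likelihood_sum; field.
rewrite -mulrBr; congr (_ * _).
rewrite mulr_sumr -sumrB; apply: eq_bigr => j _.
rewrite /F /play_round /played_arm /answer -(natr1 n); by field.
Qed.

Lemma expected_loss_ge g b h n : best_action_oracle b ->
  - (e / 2) * n%:R <= expected_loss g b h n.
Proof.
have [hp' he'] := (hp, he); move=> hb; elim: n h => [|n IH] h.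
  by rewrite /expected_loss/= mulr0 mul0r addr0 subrr.
rewrite expected_lossS//.
have h1 : - (e / 2) <= round_loss p e g (alg_act s h).
  rewrite /round_loss; case: alg_act => [i|//]; case: ifP => _; first lra.
  by apply: (@le_trans _ _ 0); [lra|apply: mulr_ge0; lra].
have h2 : (- (e / 2) * n%:R) * 4 <= \sum_(j < 4) likelihood p g (alg_act s h) j *
    expected_loss g b (play_round b s h (atom e j)) n.
  rewrite -(likelihood_sum p g (alg_act s h)) mulr_sumr; apply: ler_sum => j _.
  by rewrite mulrC; apply: ler_wpM2l; [exact: likelihood_ge0|exact: IH].
rewrite -(natr1 n); lra.
Qed.

Lemma play_round_atom b b' h j : best_action_oracle b -> best_action_oracle b' ->
  (j < 6)%N -> play_round b s h (atom e j) = play_round b' s h (atom e j).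
Proof.
move=> hb hb' hj; rewrite /play_round /played_arm.
by rewrite (oracle_atom _ he hb)// (oracle_atom _ he hb').
Qed.

(* Lower bound for the likelihood-weighted number of wrong plays among [m]    *)
(* unqueried rounds, [r] of which are still to come. Each of them multiplies  *)
(* either [x ^+ 2] or [y ^+ 2] by [1 + 8 * p ^+ 2] on average and leaves      *)
(* [x * y] unchanged on average.                                              *)
Definition potential (m r : nat) (x y : R) : R :=
  m%:R * ((x + y) / 2 - 1 / 4 -
          ((1 + 8 * p ^+ 2) ^+ r * (x ^+ 2 + y ^+ 2) - 2 * x * y) / 4).

(** The squares of [x - y + 1] and [y - x + 1] are nonnegative, which bounds the bracket of the
    potential by [x] and by [y]. *)
Lemma potential_end m N1 N2 x y : m = (N1 + N2)%N ->
  potential m 0 x y <= x * N2%:R + y * N1%:R.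
Proof.
move=> ->; rewrite /potential expr0 mul1r natrD.
have n1 : 0 <= N1%:R :> R by [].
have n2 : 0 <= N2%:R :> R by [].
have h1 : (x + y) / 2 - 1 / 4 - (x ^+ 2 + y ^+ 2 - 2 * x * y) / 4 <= x.
  by have := sqr_ge0 (x - y + 1); rewrite !expr2; lra.
have h2 : (x + y) / 2 - 1 / 4 - (x ^+ 2 + y ^+ 2 - 2 * x * y) / 4 <= y.
  by have := sqr_ge0 (y - x + 1); rewrite !expr2; lra.
have := ler_wpM2l n1 h2; have := ler_wpM2l n2 h1; lra.
Qed.

(** Playing an arm multiplies one ratio by [1], [1], [1 - 4 * p], [1 + 4 * p] on the four atoms, and
    these squares average to [1 + 8 * p ^+ 2]; the other ratio has slack. For a query both sides
    agree. *)
Lemma potential_step m r a x y :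
  4 * potential m r.+1 x y <=
  \sum_(j < 4) potential m ((a == None) + r) (x * likelihood p ord0 a j)
                                             (y * likelihood p ord_max a j).
Proof.
have np0 : 0 <= m%:R * ((1 + 8 * p ^+ 2) ^+ r) * p ^+ 2.
  have q0 : 0 <= 1 + 8 * p ^+ 2 by have := sqr_ge0 p; lra.
  by rewrite mulr_ge0 ?sqr_ge0// mulr_ge0// exprn_ge0.
have npx := mulr_ge0 np0 (sqr_ge0 x).
have npy := mulr_ge0 np0 (sqr_ge0 y).
rewrite !big_ord_recl !big_ord0 /bump /likelihood /potential/=.
case: a => [i|]; first (case: (ord2P i) => ->); rewrite /eq_op/= ?add0n ?add1n ?(exprS (_ + _));
  by set Q := _ ^+ r in npx npy *; lra.
Qed.

(** Here [x], [y] are the likelihood ratios of the instances [ord0], [ord_max] so far, and [N1],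
    [N2] count unqueried plays of [ord0], [ord_max]. Hence [N2] counts the wrong plays of the first
    instance and [N1] those of the second, and [r] plays remain to be counted. *)
Lemma potential_bound bI bII n h m r N1 N2 x y :
  best_action_oracle bI -> best_action_oracle bII ->
  0 <= x -> 0 <= y -> m = (N1 + N2 + r)%N ->
  (forall js : seq 'I_4, size js = n ->
     (queries_from bI s h [seq atom e j | j : 'I_4 <- js] + r <= n)%N) ->
  p * (1 - e) * potential m r x y - e / 2 * (x + y) * n%:R <=
  x * (p * (1 - e) * N2%:R + expected_loss ord0 bI h n) +
  y * (p * (1 - e) * N1%:R + expected_loss ord_max bII h n).
Proof.
have [hp' he'] := (hp, he); move=> hI hII; have pe0 : 0 <= p * (1 - e) by apply: mulr_ge0; lra.
elim: n h r N1 N2 x y => [|n IH] h r N1 N2 x y x0 y0 hm hq.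
all: case: r hm hq => [|r] hm hq.
(* If [r = 0], all [m] plays are counted: [potential_end] bounds them, and each later round gains at
   most [e / 2]. *)
1,3: rewrite addn0 in hm.
1,2: have := ler_wpM2l pe0 (potential_end x y hm);
   have := ler_wpM2l x0 (expected_loss_ge ord0 h _ hI);
   have := ler_wpM2l y0 (expected_loss_ge ord_max h _ hII).
- by move=> /(_ 0) + /(_ 0); lra.
- by move=> /(_ n.+1) + /(_ n.+1); lra.
- by have := hq [::] erefl; rewrite addnS.
rewrite !expected_lossS//.
(* The induction hypothesis along one atom: [r'], [N1'], [N2'] are the counters after the round, and
   the number of plays still to count drops exactly when the round is not a query. *)
have step (j : 'I_4) r' N1' N2' : m = (N1' + N2' + r')%N ->
    ((alg_act s h != None) + r' = r.+1)%N ->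
    p * (1 - e) * potential m r' (x * likelihood p ord0 (alg_act s h) j) (y * likelihood p ord_max (alg_act s h) j) -
      e / 2 * (x * likelihood p ord0 (alg_act s h) j + y * likelihood p ord_max (alg_act s h) j) * n%:R <=
    x * likelihood p ord0 (alg_act s h) j * (p * (1 - e) * N2'%:R +
       expected_loss ord0 bI (play_round bI s h (atom e j)) n) +
    y * likelihood p ord_max (alg_act s h) j * (p * (1 - e) * N1'%:R +
       expected_loss ord_max bII (play_round bII s h (atom e j)) n).
  move=> hm' hr.
  rewrite (@play_round_atom bII bI)//; last by case: j => [[|[|[|[|]]]]].
  apply: IH => //; try by apply: mulr_ge0 => //; exact: likelihood_ge0.
  move=> js hjs; have := hq (j :: js); rewrite /= hjs => /(_ erefl).
  rewrite queries_from_cons; case: (alg_act s h) hr => [i|] /=; lia.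
have {}step r' N1' N2' : m = (N1' + N2' + r')%N ->
    ((alg_act s h != None) + r' = r.+1)%N ->
    p * (1 - e) * (\sum_(j < 4) potential m r' (x * likelihood p ord0 (alg_act s h) j)
                                     (y * likelihood p ord_max (alg_act s h) j)) -
      e / 2 * (x + y) * 4 * n%:R <=
    x * (p * (1 - e) * N2'%:R * 4 + \sum_(j < 4) likelihood p ord0 (alg_act s h) j *
       expected_loss ord0 bI (play_round bI s h (atom e j)) n) +
    y * (p * (1 - e) * N1'%:R * 4 + \sum_(j < 4) likelihood p ord_max (alg_act s h) j *
       expected_loss ord_max bII (play_round bII s h (atom e j)) n).
  move=> hm' hr.
  have := @ler_sum _ _ (index_enum 'I_4) predT _ _ (fun j _ => step j r' N1' N2' hm' hr).
  rewrite sumrB -mulr_sumr => H; apply: le_trans (le_trans H _).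
    rewrite lerB// -mulr_suml -mulr_sumr big_split/= -!mulr_sumr !likelihood_sum.
    by rewrite le_eqVlt -mulrDl mulrA eqxx.
  rewrite le_eqVlt; apply/orP; left; apply/eqP.
  rewrite big_split/=; congr (_ + _);
    [rewrite -(likelihood_sum p ord0 (alg_act s h))|
     rewrite -(likelihood_sum p ord_max (alg_act s h))];
    by rewrite mulr_sumr -big_split/= mulr_sumr; apply: eq_bigr => j _; ring.
have ex0 : 0 <= e * x by apply: mulr_ge0; lra.
have ey0 : 0 <= e * y by apply: mulr_ge0; lra.
have := potential_step m r (alg_act s h) x y.
rewrite -(natr1 n); case: (alg_act s h) step => [i|] /= step.
- case: (ord2P i) step => -> step /(ler_wpM2l pe0).
  + by have := step r N1.+1 N2 ltac:(lia) ltac:(by []); rewrite /round_loss/= /eq_op/= -(natr1 N1); lra.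
  + by have := step r N1 N2.+1 ltac:(lia) ltac:(by []); rewrite /round_loss/= /eq_op/= -(natr1 N2); lra.
- move=> /(ler_wpM2l pe0).
  by have := step r.+1 N1 N2 ltac:(lia) ltac:(by []); rewrite /round_loss/=; lra.
Qed.

End potential.

(** * Averaging over the seed *)

Lemma total_reward_bounds (R : realType) n (A : algorithm R n) b s
    (xs : seq (n.-tuple R)) : (forall x, x \in xs -> reward_cube R n x) ->
  0 <= total_reward (A := A) b s xs <= (size xs)%:R.
Proof.
elim/last_ind: xs => [|xs x IH] h; first by rewrite /total_reward big_nil lexx.
have /IH : forall y, y \in xs -> reward_cube R n y.
  by move=> y hy; apply: h; rewrite mem_rcons inE hy orbT.
have := h x; rewrite mem_rcons inE eqxx => /(_ isT).
move=> /(_ (played_arm b s (run b s xs) x)).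
rewrite /total_reward /run foldl_rcons size_rcons /play_round big_rcons/= -(natr1 (size xs)).
lra.
Qed.

Lemma measurable_reward_cube (R : realType) n : measurable (reward_cube R n).
Proof.
rewrite (_ : reward_cube R n = \bigcap_(i in [set: 'I_n])
    ((fun x : n.-tuple R => tnth x i) @^-1` `[0, 1])).
  apply: fin_bigcap_measurable => // i _; rewrite -[X in measurable X]setTI.
  exact: measurable_tnth.
apply/seteqP; split => x /= h i; have := h i; rewrite /= in_itv/=; first by [].
exact.
Qed.

Section hard_law.
Context {R : realType}.
Variables (p e : R).
Hypotheses (hp : 0 <= p <= 1 / 4) (he : 0 < e < 1 / 2).

Lemma weight_ge0 g j : 0 <= weight p g j.
Proof. by have := hp; rewrite /weight; case: (g == ord0); case: j => [|[|[|[|[|[|j]]]]]] /=; lra. Qed.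

Lemma weight_sum g : \sum_(j < 6) weight p g j = 1.
Proof.
by rewrite !big_ord_recl big_ord0 /bump /weight/=; case: ifP => _; field.
Qed.

Lemma mean_good_arm g : \sum_(j < 6) weight p g j * tnth (atom e j) g = 1 / 2.
Proof.
rewrite !big_ord_recl big_ord0 /bump /weight/=; case: (ord2P g) => ->;
  by rewrite !(tnth_nth 0)/= /eq_op/=; field.
Qed.

Lemma atom_cube j : reward_cube R 2 (atom e j).
Proof.
have := he; move=> he' i; rewrite (tnth_nth 0).
by case: (ord2P i) => ->; case: j => [|[|[|[|[|j]]]]] /=; lra.
Qed.

Variables (D : probability (2.-tuple R) R) (g : 'I_2).
Hypothesis hD : is_finite_law 6 (weight p g) (atom e) D.

Lemma finite_law_reward_cube : D (reward_cube R 2) = 1%E.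
Proof.
have mc := @measurable_reward_cube R 2.
have := @hD (EFin \o \1_(reward_cube R 2)) _ _.
rewrite integral_indic// setIT => ->; first last.
- by move=> y; rewrite lee_fin.
- exact/measurable_EFinP/measurable_indic.
rewrite -[RHS](congr1 EFin (weight_sum g)) -sumEFin; apply: eq_bigr => j _.
by rewrite /= indicE mem_set ?mule1//; exact: atom_cube.
Qed.

Variables (A : algorithm R 2) (b : nat -> 2.-tuple R -> 'I_2) (T : nat).
Hypothesis hb : best_action_oracle b.

Definition expected_reward (s : alg_seed A) : R :=
  T%:R / 2 - expected_loss s p e g b [::] T.

Lemma expected_rewardE s : expected_reward s =
  mean 6 (weight p g) (atom e) T (total_reward b s).
Proof. by rewrite /expected_reward /expected_loss big_nil add0r opprB addrC subrK. Qed.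

Let total_reward_measurable : measurable_fun setT
  (fun u : alg_seed A * T.-tuple (2.-tuple R) => total_reward b u.1 u.2).
Proof.
(* The sequence of reward vectors is continued by the zero vector after the horizon. *)
pose x t (u : alg_seed A * T.-tuple (2.-tuple R)) := nth [tuple 0; 0] u.2 t.
have mx t : measurable_fun setT (x t).
  have [ht|ht] := ltnP t T.
    rewrite (_ : x t = (fun y : T.-tuple (2.-tuple R) => tnth y (Ordinal ht)) \o snd).
      by apply: measurableT_comp => //; exact: measurable_tnth.
    by apply/funext => u; rewrite /x /= (tnth_nth [tuple 0; 0]).
  rewrite (_ : x t = cst [tuple 0; 0]); first exact: measurable_cst.
  by apply/funext => u; rewrite /x nth_default// size_tuple.
have := measurable_total_reward hb measurable_fst mx T.
congr measurable_fun; apply/funext => u; congr total_reward.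
by rewrite /x -[RHS](mkseq_nth [tuple 0; 0]) [size u.2]size_tuple.
Qed.

Let atoms_reward (s : alg_seed A) (js : seq 'I_6) : size js = T ->
  0 <= total_reward b s [seq atom e j | j : 'I_6 <- js] <= T%:R.
Proof.
move=> <-; rewrite -(size_map (fun j : 'I_6 => atom e j)).
by apply: total_reward_bounds => x /mapP[j _ ->]; exact: atom_cube.
Qed.

Lemma measurable_expected_reward : measurable_fun setT (fun s => (expected_reward s)%:E).
Proof.
under eq_fun do rewrite expected_rewardE.
have h (s : alg_seed A) (js : seq (ordinal 6)) : size js = T -> 0 <= total_reward b s [seq atom e j | j : 'I_6 <- js].
  by move=> /(atoms_reward s)/andP[].
exact: (measurable_mean (weight_ge0 g) (weight_sum g) hD total_reward_measurable h).
Qed.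

Lemma expected_reward_ge0 s : 0 <= expected_reward s.
Proof.
rewrite expected_rewardE; apply: (mean_ge (weight_ge0 g) (weight_sum g)) => js.
by move=> /(atoms_reward s)/andP[].
Qed.

(** The benchmark is at least the total of arm [g], which is [T / 2] by [mean_good_arm]. *)
Lemma regret_ge :
  ((T%:R / 2)%:E - \int[alg_law A]_s (expected_reward s)%:E <= regret A D b T)%E.
Proof.
rewrite /regret [X in (_ <= _ - X)%E](_ : _ =
    \int[alg_law A]_s (expected_reward s)%:E)%E; last first.
  rewrite [RHS](eq_integral (fun s => (mean 6 (weight p g) (atom e) T
    (total_reward b s))%:E)) => [|s _]; last by rewrite expected_rewardE.
  apply: (expectation_mean (weight_ge0 g) (weight_sum g) hD (alg_law A) total_reward_measurable).
  by move=> s js /(atoms_reward s)/andP[].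
apply: leeB => //; apply: le_trans (le_bigmax _ _ g).
rewrite (eq_bigr (fun=> (1 / 2)%:E)) => [|t _].
  by rewrite sumEFin sumr_const card_ord lee_fin -[leRHS]mulr_natl div1r.
have -> : (fun w : alg_seed A * T.-tuple (2.-tuple R) => tnth (tnth w.2 t) g) =
    (fun w => tnth (nth [tuple 0; 0] w.2 t) g).
  by apply/funext => w; rewrite -tnth_nth.
rewrite (expectation_mean (weight_ge0 g) (weight_sum g) hD (alg_law A)
  (f := fun _ xs => tnth (nth [tuple 0; 0] xs t) g)).
- rewrite (mean_nth _ (weight_sum g) _ (fun y => tnth y g) (ltn_ord t)) mean_good_arm.
  by rewrite integral_cst//= [X in (_ * X)%E](_ : _ = 1%E) ?mule1//; exact: probability_setT.
- apply: (measurableT_comp (f := fun y : 2.-tuple R => tnth y g)); first exact: measurable_tnth.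
  rewrite (_ : (fun w => _) = (fun y : T.-tuple (2.-tuple R) => tnth y t) \o snd).
    by apply: measurableT_comp => //; exact: measurable_tnth.
  by apply/funext => w; rewrite /= (tnth_nth [tuple 0; 0]).
- move=> _ js hjs.
  have [j ->] : exists j : 'I_6, nth [tuple 0; 0] [seq atom e j | j : 'I_6 <- js] t = atom e j.
    case: js hjs => [h0|j0 js]; first by case: t => i /=; rewrite -h0.
    by move=> hjs; exists (nth j0 (j0 :: js) t); rewrite (nth_map j0) ?hjs.
  by have /andP[] := @atom_cube j g.
Qed.

End hard_law.

(** * Choice of the parameters and conclusion *)

Lemma exprn_1D_le (R : realFieldType) (x : R) r : 0 <= x -> (1 + x) ^+ r * (1 - r%:R * x) <= 1.
Proof.
move=> x0; elim: r => [|r IH]; first by rewrite expr0 mul0r subr0 mul1r.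
apply: le_trans IH; rewrite exprSr -mulrA; apply: ler_wpM2l.
  by apply: exprn_ge0; lra.
rewrite -(natr1 r); have := sqr_ge0 x; have : 0 <= r%:R * x ^+ 2 by rewrite mulr_ge0 ?sqr_ge0.
lra.
Qed.

Section two_instances.
Context {R : realType}.
Variables (T k : nat).
Hypothesis hk : (1 <= k <= T - 1)%N.

Let m := (T - k)%N.
(* [8 * gap_prob ^+ 2 * m = 1 / 8] keeps the likelihood ratios of order one;  *)
(* [query_gain * T = 1 / 64] makes the total gain from queries negligible.    *)
Definition gap_prob : R := (8 * Num.sqrt m%:R)^-1.
Definition query_gain : R := (64 * T%:R)^-1.

Let sm_ge1 : 1 <= Num.sqrt m%:R :> R.
Proof. by rewrite -[leLHS]sqrtr1 ler_wsqrtr// (ler_nat _ 1); lia. Qed.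

Let T_ge1 : 1 <= T%:R :> R.
Proof. by rewrite (ler_nat _ 1); lia. Qed.

Lemma gap_prob_bounds : 0 <= gap_prob <= 1 / 4.
Proof.
have h := sm_ge1; rewrite /gap_prob invr_ge0 mulr_ge0 ?sqrtr_ge0//=.
by rewrite div1r lef_pV2 ?posrE//; lra.
Qed.

Lemma query_gain_bounds : 0 < query_gain < 1 / 2.
Proof.
have h := T_ge1; have h64 : 0 < 64 * T%:R :> R by lra.
apply/andP; split; first by rewrite /query_gain invr_gt0.
by rewrite /query_gain div1r ltf_pV2 ?posrE//; lra.
Qed.

(** [potential_bound] from the empty history, with ratios [x = y = 1] and at least [m] unqueried
    rounds to come. Two oracles are allowed because each instance may be challenged by its own
    tie-breaking rule. *)
Lemma total_expected_loss_ge (A : algorithm R 2) (s : alg_seed A) b0 b1 :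
  within_budget A T k -> best_action_oracle b0 -> best_action_oracle b1 ->
  Num.sqrt m%:R / 64 <= expected_loss s gap_prob query_gain ord0 b0 [::] T +
                        expected_loss s gap_prob query_gain ord_max b1 [::] T.
Proof.
move=> hA hb0 hb1.
have hp := gap_prob_bounds; have he := query_gain_bounds.
have hq (js : seq 'I_4) : size js = T ->
    (queries_from b0 s [::] [seq atom query_gain j | j : 'I_4 <- js] + m <= T)%N.
  move=> hjs; have hsz : size [seq atom query_gain j | j : 'I_4 <- js] == T.
    by rewrite size_map hjs.
  have : (queries_from b0 s [::] [seq atom query_gain j | j : 'I_4 <- js] <= k)%N.
    apply: (hA b0 hb0 s (Tuple hsz)) => t.
    by have /mapP[j _ ->] := mem_tnth t (Tuple hsz); exact: atom_cube.
  by move: hk; rewrite /m; lia.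
have := @potential_bound R A s _ _ hp he b0 b1 T [::] m m 0 0 1 1 hb0 hb1 ler01 ler01
  (esym (add0n m)) hq.
rewrite /potential.
set Q := _ ^+ m; set V0 := expected_loss _ _ _ _ _ _ _; set V1 := expected_loss _ _ _ _ _ _ _.
have hs := sm_ge1; have hT := T_ge1.
have hsm : Num.sqrt m%:R * Num.sqrt m%:R = m%:R :> R by rewrite -expr2 sqr_sqrtr.
have hpm : gap_prob * m%:R = Num.sqrt m%:R / 8.
  by rewrite -[in LHS]hsm /gap_prob; field; rewrite gt_eqF//; lra.
have heT : query_gain * T%:R = 1 / 64.
  by rewrite /query_gain; field; rewrite gt_eqF//; lra.
have hQ : Q <= 8 / 7.
  have hx : m%:R * (8 * gap_prob ^+ 2) = 1 / 8.
    have -> : m%:R * (8 * gap_prob ^+ 2) = 8 * (gap_prob * m%:R) * gap_prob by ring.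
    rewrite hpm /gap_prob.
    by field; rewrite gt_eqF//; lra.
  have := @exprn_1D_le R (8 * gap_prob ^+ 2) m; rewrite hx -/Q.
  by have := sqr_ge0 gap_prob; lra.
have -> : gap_prob * (1 - query_gain) * (m%:R * ((1 + 1) / 2 - 1 / 4 -
    (Q * (1 ^+ 2 + 1 ^+ 2) - 2 * 1 * 1) / 4)) =
  (gap_prob * m%:R) * ((1 - query_gain) * (5 / 4 - Q / 2)) by field.
have -> : query_gain / 2 * (1 + 1) * T%:R = query_gain * T%:R by field.
rewrite hpm heT mulr0 !add0r !mul1r.
(* From [query_gain <= 1 / 64] and [Q <= 8 / 7]. The remaining term [1 / 64], the gain from queries,
   is absorbed since [sqrt m >= 1]. *)
have : 63 / 64 * (5 / 4 - 4 / 7) <= (1 - query_gain) * (5 / 4 - Q / 2).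
  apply: ler_pM; try lra.
  have : query_gain <= 1 / 64; last lra.
  by rewrite -heT ler_peMr//; lra.
have : 0 <= Num.sqrt m%:R / 8 :> R by lra.
move=> h1 /(ler_wpM2l h1); lra.
Qed.

(** If both instances failed, each would do so for some oracle, [b0] and [b1]. Their expected
    rewards would then add up to more than [T - sqrt m / 64], whereas for every seed the sum is at
    most that. *)
Lemma regret_lower_bound (A : algorithm R 2) : within_budget A T k ->
  exists D : probability (2.-tuple R) R, D (reward_cube R 2) = 1%E /\
  forall b, best_action_oracle b ->
    ((1 / 128 * Num.sqrt m%:R)%:E <= regret A D b T)%E.
Proof.
move=> hA; have hp := gap_prob_bounds; have he := query_gain_bounds.
have law g := finite_law_exists (atom query_gain) (weight_ge0 hp g) (weight_sum gap_prob g).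
have [D0 hD0] := law ord0; have [D1 hD1] := law ord_max.
have bad g (D : probability (2.-tuple R) R) :
    is_finite_law 6 (weight gap_prob g) (atom query_gain) D ->
    (D (reward_cube R 2) = 1%E /\
     forall b, best_action_oracle b ->
       ((1 / 128 * Num.sqrt m%:R)%:E <= regret A D b T)%E) \/
    exists2 b, best_action_oracle b &
      ((T%:R / 2)%:E - \int[alg_law A]_s (expected_reward gap_prob query_gain g b T s)%:E
       < (1 / 128 * Num.sqrt m%:R)%:E)%E.
  move=> hD; case: (pselect (forall b, best_action_oracle b ->
       ((1 / 128 * Num.sqrt m%:R)%:E <= regret A D b T)%E)) => [h|/existsNP[b]].
    by left; split=> //; exact: (finite_law_reward_cube he hD).
  move=> /not_implyP[hb /negP]; rewrite -ltNge => h; right; exists b => //.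
  exact: le_lt_trans (regret_ge hp he hD A T hb) h.
have [h|[b0 hb0 h0]] := bad _ _ hD0; first by exists D0.
have [h|[b1 hb1 h1]] := bad _ _ hD1; first by exists D1.
exfalso.
pose f0 s := (expected_reward gap_prob query_gain ord0 b0 T (A := A) s)%:E.
pose f1 s := (expected_reward gap_prob query_gain ord_max b1 T (A := A) s)%:E.
have p0 s : (0 <= f0 s)%E by rewrite lee_fin (expected_reward_ge0 hp he).
have p1 s : (0 <= f1 s)%E by rewrite lee_fin (expected_reward_ge0 hp he).
have m0 : measurable_fun setT f0 := measurable_expected_reward hp he hD0 T hb0.
have m1 : measurable_fun setT f1 := measurable_expected_reward hp he hD1 T hb1.
have i0 : (0 <= \int[alg_law A]_s f0 s)%E by apply: integral_ge0.
have i1 : (0 <= \int[alg_law A]_s f1 s)%E by apply: integral_ge0.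
have hsum : (\int[alg_law A]_s f0 s + \int[alg_law A]_s f1 s <=
    (T%:R - Num.sqrt m%:R / 64)%:E)%E.
  rewrite -ge0_integralD//.
  have L1 : alg_law A setT = 1%E by exact: probability_setT.
  rewrite -[leRHS]mule1 -L1 -integral_cst//.
  apply: ge0_le_integral => //.
  - by move=> s _; apply: adde_ge0.
  - exact: emeasurable_funD.
  - move=> s _; rewrite /f0 /f1 -EFinD lee_fin /expected_reward.
    by have := total_expected_loss_ge s hA hb0 hb1; lra.
(* Nonnegativity and the bound on the sum make both integrals finite, which leaves real
   arithmetic. *)
move: h0 h1 hsum i0 i1; rewrite -/f0 -/f1.
case: (\int[alg_law A]_s f0 s)%E => [x| |] //; case: (\int[alg_law A]_s f1 s)%E => [y| |] //.
by rewrite -!EFinB -EFinD !lte_fin !lee_fin; lra.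
Qed.

End two_instances.

Theorem theorem3p1 (R : realType) :
  exists c : R, 0 < c /\
    forall T k : nat, (1 <= T)%N -> (1 <= k <= T - 1)%N ->
    forall A : algorithm R 2, within_budget A T k ->
    exists D : probability (2.-tuple R) R,
      D (reward_cube R 2) = 1%E /\
      forall b : nat -> 2.-tuple R -> 'I_2, best_action_oracle b ->
        ((c * Num.sqrt (T%:R - k%:R))%:E <= regret A D b T)%E.
Proof.
exists (1 / 128); split=> [|T k _ hk A hA]; first by lra.
rewrite -natrB; last by lia.
exact: regret_lower_bound.
Qed.
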